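(* Let $X$ be a cocompact proper geodesic metric space whose Morse boundary contains at least three points. Then every cobounded quasi-action on $X$ has a topological completion.
   Context: $X$ is cocompact if its isometry group acts cocompactly, i.e. there is a compact $K\subseteq X$ whose translates under isometries cover $X$. A geodesic ray $\gamma$ is Morse if there is a function $\phi:[1,\infty)\times[0,\infty)\to[0,\infty)$ such that every $(K,A)$-quasi-geodesic with endpoints on $\gamma$ lies in the $\phi(K,A)$-neighbourhood of $\gamma$. The Morse boundary of $X$ is the set of Morse geodesic rays modulo finite Hausdorff distance. A $(K,A)$-quasi-action of a group $G$ on $X$ assigns to each $g$ a $(K,A)$-quasi-isometry $x\mapsto g\cdot x$ with $d(h\cdot(g\cdot x),hg\cdot x)\le A$, $d(e\cdot x,x)\le A$; cobounded means for some $r$ any $x,y$ admit $g$ with $d(g\cdot x,y)\le r$. $T\subseteq G$ is bounded if $\{t\cdot x_0:t\in T\}$ is bounded. A topological completion is a homomorphism $\rho:G\to\hat G$ to a Hausdorff locally compact group with dense image such that $T\subseteq G$ is bounded iff $\overline{\rho(T)}$ is compact. *)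

(* Defs.v *)
From HB Require Import structures.
From mathcomp Require Import all_boot all_order all_algebra.
From mathcomp Require Import all_classical all_reals all_analysis.
Set Implicit Arguments. Unset Strict Implicit. Unset Printing Implicit Defensive.
Import Order.TTheory GRing.Theory Num.Theory.
Local Open Scope classical_set_scope.
Local Open Scope ring_scope.

(* list membership in Prop (no eqType needed) *)
Fixpoint lmem (I : Type) (i : I) (s : list I) : Prop :=
  match s with nil => False | cons j s' => j = i \/ lmem i s' end.

Definition is_group (G : Type) (mul : G -> G -> G) (one : G) (inv : G -> G) :=
  (forall a b c, mul a (mul b c) = mul (mul a b) c) /\
  (forall a, mul one a = a) /\ (forall a, mul a one = a) /\
  (forall a, mul (inv a) a = one) /\ (forall a, mul a (inv a) = one).

Record topGroup := TopGroup {
  tg_car : topologicalType;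
  tg_mul : tg_car -> tg_car -> tg_car;
  tg_one : tg_car;
  tg_inv : tg_car -> tg_car;
  tg_group : is_group tg_mul tg_one tg_inv;
  tg_mul_cont : continuous (fun p : tg_car * tg_car => tg_mul p.1 p.2);
  tg_inv_cont : continuous tg_inv }.

Definition top_completion (G : Type) (mul : G -> G -> G) (bdd : set G -> Prop) :=
  exists (H : topGroup) (rho : G -> tg_car H),
    hausdorff_space (tg_car H) /\
    locally_compact [set: tg_car H] /\
    (forall g h, rho (mul g h) = tg_mul (rho g) (rho h)) /\
    dense (range rho) /\
    (forall T : set G, bdd T <-> compact (closure (rho @` T))).

Section Metric.
Context {R : realType} {X : Type} (d : X -> X -> R).

Definition is_metric :=
  (forall x y, 0 <= d x y) /\ (forall x y, d x y = 0 <-> x = y) /\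
  (forall x y, d x y = d y x) /\ (forall x y z, d x z <= d x y + d y z).

Definition mball (x : X) (r : R) := [set y | d x y < r].
Definition closed_mball (x : X) (r : R) := [set y | d x y <= r].

Definition mopen (U : set X) :=
  forall x, U x -> exists2 e : R, 0 < e & mball x e `<=` U.

Definition mcompact (K : set X) :=
  forall (I : Type) (U : I -> set X), (forall i, mopen (U i)) ->
    (forall x, K x -> exists i, U i x) ->
    exists s : list I, forall x, K x -> exists2 i, lmem i s & U i x.

Definition proper_space := forall x r, mcompact (closed_mball x r).

Definition geodesic_space :=
  forall x y, exists g : R -> X, g 0 = x /\ g (d x y) = y /\
    forall s t, 0 <= s <= d x y -> 0 <= t <= d x y -> d (g s) (g t) = `|s - t|.

Definition isometry (f : X -> X) :=
  (forall x y, d (f x) (f y) = d x y) /\ (forall y, exists x, f x = y).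

Definition cocompact :=
  exists K : set X, mcompact K /\
    forall x, exists f, isometry f /\ exists2 k, K k & f k = x.

Definition geodesic_ray (g : R -> X) :=
  forall s t, 0 <= s -> 0 <= t -> d (g s) (g t) = `|s - t|.

Definition on_ray (g : R -> X) (x : X) := exists2 t, 0 <= t & g t = x.

Definition quasi_geodesic (K A a b : R) (q : R -> X) :=
  a <= b /\ forall s t, a <= s <= b -> a <= t <= b ->
    `|s - t| / K - A <= d (q s) (q t) /\ d (q s) (q t) <= K * `|s - t| + A.

Definition Morse_ray (g : R -> X) :=
  geodesic_ray g /\
  exists phi : R -> R -> R,
    (forall K A, 1 <= K -> 0 <= A -> 0 <= phi K A) /\
    forall (K A a b : R) (q : R -> X), 1 <= K -> 0 <= A ->
      quasi_geodesic K A a b q -> on_ray g (q a) -> on_ray g (q b) ->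
      forall t, a <= t <= b -> exists2 s, 0 <= s & d (q t) (g s) <= phi K A.

Definition finite_hausdorff (g1 g2 : R -> X) :=
  exists C : R,
    (forall s, 0 <= s -> exists2 t, 0 <= t & d (g1 s) (g2 t) <= C) /\
    (forall t, 0 <= t -> exists2 s, 0 <= s & d (g1 s) (g2 t) <= C).

(* the Morse boundary (Morse rays modulo finite Hausdorff distance)
   contains at least three points *)
Definition Morse_boundary_ge3 :=
  exists g1 g2 g3, Morse_ray g1 /\ Morse_ray g2 /\ Morse_ray g3 /\
    ~ finite_hausdorff g1 g2 /\ ~ finite_hausdorff g1 g3 /\
    ~ finite_hausdorff g2 g3.

Definition quasi_isometry (K A : R) (f : X -> X) :=
  (forall x y, d x y / K - A <= d (f x) (f y) /\ d (f x) (f y) <= K * d x y + A) /\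
  (forall y, exists x, d (f x) y <= A).

Definition quasi_action (G : Type) (mul : G -> G -> G) (one : G)
    (K A : R) (act : G -> X -> X) :=
  1 <= K /\ 0 <= A /\
  (forall g, quasi_isometry K A (act g)) /\
  (forall g h x, d (act h (act g x)) (act (mul h g) x) <= A) /\
  (forall x, d (act one x) x <= A).

Definition cobounded (G : Type) (act : G -> X -> X) :=
  exists r : R, forall x y, exists g, d (act g x) y <= r.

Definition qa_bounded (G : Type) (act : G -> X -> X) (x0 : X) (T : set G) :=
  exists r : R, forall t, T t -> d (act t x0) x0 <= r.

End Metric.

(* Main.v *)
(* The Morse property makes X rigid: if a (K,A)-quasi-isometric embedding h moves
   every point of a large ball about x by at most D, then it moves x by at most
   a constant B(K,A) that does not depend on D (only the radius of the ball does).
   Indeed two non-asymptotic Morse rays form a bi-infinite quasi-geodesic; its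
   image under h stays near the two rays, uniformly in D, because its far ends can
   be closed up by geodesics through nearest points. With three rays based near o,
   h o is close to at least two of them; these diverge, so h o is close to o.
   Cocompactness transports this from o to every point of X.

   For the quasi-action, let V n be the set of g that move every point of the
   ball of radius n rho about x0 by at most c. Products, inverses and conjugates
   by bounded elements displace by a larger constant D on a larger ball, and
   rigidity brings D back to c. So the V n are a base at the identity of a group
   topology, in which bounded subsets are totally bounded because X is proper;
   the group of Cauchy sequences modulo equivalence is the completion. *)
Require Import Defs.
From HB Require Import structures.
From mathcomp Require Import all_boot all_order all_algebra.
From mathcomp Require Import all_classical all_reals all_analysis.
From mathcomp Require Import ring lra.
Set Implicit Arguments. Unset Strict Implicit. Unset Printing Implicit Defensive.
Import Order.TTheory GRing.Theory Num.Theory.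
Local Open Scope classical_set_scope.
Local Open Scope ring_scope.

Section Metric.
Context {R : realType} {X : Type} (d : X -> X -> R).
Hypothesis d_metric : is_metric d.

Lemma dist_ge0 x y : 0 <= d x y.
Proof. by case: d_metric => + _; apply. Qed.

Lemma distxx x : d x x = 0.
Proof. by case: d_metric => _ [+ _] => ->. Qed.

Lemma distC x y : d x y = d y x.
Proof. by case: d_metric => _ [_ [+ _]]; apply. Qed.

Lemma dist_triangle y x z : d x z <= d x y + d y z.
Proof. by case: d_metric => _ [_ [_ +]]; apply. Qed.

Lemma dist_trianglel y x z : d x z <= d y x + d y z.
Proof. by rewrite (distC y x); exact: dist_triangle. Qed.

Lemma dist_triangler y x z : d x z <= d x y + d z y.
Proof. by rewrite (distC z y); exact: dist_triangle. Qed.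

Lemma dist_perturb C x x' y y' : d x x' <= C -> d y y' <= C ->
  d x y <= d x' y' + 2 * C.
Proof.
by have := dist_triangle x' x y; have := dist_triangler y' x' y; lra.
Qed.

Lemma isometry_inverse f : Defs.isometry d f -> exists e,
  (forall x y, d (e x) y = d x (f y)) /\ (forall x y, d (e x) (e y) = d x y).
Proof.
move=> [f_iso /choice[e fe]]; exists e.
by split=> x y; rewrite -f_iso ?fe.
Qed.

Lemma mball_open x r : mopen d (mball d x r).
Proof.
move=> y; rewrite /mball /= => yr; exists (r - d x y); first by rewrite subr_gt0.
by move=> z /=; have := dist_triangle y x z; lra.
Qed.

Lemma mcompact_net (S : set X) : mcompact d S ->
  exists s, forall x, S x -> exists2 y, lmem y s & d y x < 1.
Proof.
move=> /(_ X (fun y => mball d y 1)); apply; first by move=> y; exact: mball_open.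
by move=> x _; exists x; rewrite /mball /= distxx.
Qed.

Lemma mcompact_bounded (S : set X) o : mcompact d S ->
  exists r, forall x, S x -> d o x <= r.
Proof.
move=> /mcompact_net[s Ss].
have [r sr] : exists r, forall y, lmem y s -> d o y <= r.
  elim: s {Ss} => [|y s [r sr]]; first by exists 0.
  exists (Num.max (d o y) r) => z /= [<-|/sr zr]; first by rewrite le_max lexx.
  by rewrite le_max zr orbT.
exists (r + 1) => x /Ss[y /sr yr yx]; have := dist_triangle y o x; lra.
Qed.

(** * Quasi-geodesics *)

Lemma quasi_geodesicP (K A a b : R) (q : R -> X) : 1 <= K ->
  quasi_geodesic d K A a b q <->
  a <= b /\ forall s t, a <= s -> s <= t -> t <= b ->
    t - s <= K * (d (q s) (q t) + A) /\ d (q s) (q t) <= K * (t - s) + A.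
Proof.
move=> K_ge1; have K_gt0 : 0 < K by lra.
have ler_divB x y : (x / K - A <= y) = (x <= K * (y + A)).
  by rewrite lerBlDr ler_pdivrMr // mulrC.
split=> -[ab q_bounds]; split=> // s t.
  move=> as_ st tb; have := q_bounds s t.
  rewrite ler_divB distrC ger0_norm ?subr_ge0 //.
  by apply; rewrite ?as_ ?tb ?(le_trans st) ?(le_trans as_).
move=> /andP[as_ sb] /andP[at_ tb]; rewrite ler_divB.
case: (leP s t) => [st|/ltW ts].
  by rewrite distrC ger0_norm ?subr_ge0 //; exact: q_bounds.
by rewrite ger0_norm ?subr_ge0 // distC; exact: q_bounds.
Qed.

Lemma quasi_geodesic_sub (K A a b a' b' : R) (q : R -> X) :
  a <= a' -> a' <= b' -> b' <= b ->
  quasi_geodesic d K A a b q -> quasi_geodesic d K A a' b' q.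
Proof.
move=> aa' a'b' b'b [_ q_bounds]; split=> // s t /andP[a's sb'] /andP[a't tb'].
by apply: q_bounds; rewrite ?(le_trans aa') ?(le_trans _ b'b).
Qed.

Lemma quasi_geodesic_opp (K A a b : R) (q : R -> X) :
  quasi_geodesic d K A a b q -> quasi_geodesic d K A (- b) (- a) (q \o -%R).
Proof.
move=> [ab q_bounds]; split; first by rewrite lerN2.
move=> s t /andP[bs sa] /andP[bt ta].
have -> : `|s - t| = `|- s - - t| by rewrite opprK distrC addrC.
by apply: q_bounds; rewrite lerNr lerNl ?sa ?ta.
Qed.

Lemma quasi_geodesic_perturb (K A C a b : R) (q q' : R -> X) : 1 <= K ->
  (forall t, d (q t) (q' t) <= C) ->
  quasi_geodesic d K A a b q -> quasi_geodesic d K (A + 2 * C) a b q'.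
Proof.
move=> K_ge1 qq' /(quasi_geodesicP _ _ _ _ K_ge1)[ab q_bounds].
apply/quasi_geodesicP => //; split=> // s t as_ st tb.
have [q_lower q_upper] := q_bounds s t as_ st tb.
have q'qs := qq' s; rewrite distC in q'qs; have q'qt := qq' t; rewrite distC in q'qt.
split.
  apply: le_trans q_lower _; rewrite ler_pM2l; last lra.
  by have := dist_perturb (qq' s) (qq' t); lra.
by have := dist_perturb q'qs q'qt; lra.
Qed.

Definition almost_nearest (z : X) (q : R -> X) (a b t : R) :=
  forall s, a <= s <= b -> d z (q t) <= d z (q s) + 1.

Lemma almost_nearest_exists z q (a b : R) : a <= b ->
  exists2 t, a <= t <= b & almost_nearest z q a b t.
Proof.
move=> ab; pose E := [set d z (q t) | t in [set t | a <= t <= b]].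
have lbE : has_lbound E by exists 0 => _ [t _ <-]; exact: dist_ge0.
have infE : has_inf E by split=> //; exists (d z (q a)), a => //=; rewrite lexx.
have [_ [t tab <-] tE] := inf_adherent ltr01 infE.
exists t => // s sab; apply: ltW; apply: lt_le_trans tE _.
by rewrite lerD2r; apply: ge_inf => //; exists s.
Qed.

Lemma almost_nearest_sub z q (a b a' b' t : R) : a <= a' -> b' <= b ->
  almost_nearest z q a b t -> almost_nearest z q a' b' t.
Proof.
move=> aa' b'b tmin s /andP[a's sb'].
by apply: tmin; rewrite (le_trans aa') ?(le_trans sb').
Qed.

Lemma almost_nearest_detour x y z w : d y z <= d x z + 1 ->
  d y w + d w z = d y z -> d y w <= d x w + 1 /\ d x y <= 2 * d x w + 1.
Proof.
by have := dist_triangle w x z; have := dist_triangler w x y; split; lra.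
Qed.

Hypothesis d_geodesic : geodesic_space d.

Lemma geodesic_extension (q : R -> X) (b : R) z :
  exists p, [/\ p (b + d z (q b)) = z, forall t, t <= b -> p t = q t &
    forall s t, b <= s -> s <= t -> t <= b + d z (q b) -> d (p s) (p t) = t - s].
Proof.
have [c] := d_geodesic (q b) z; rewrite distC => -[c0 [cl cg]].
have l0 := dist_ge0 z (q b).
exists (fun t => if t <= b then q t else c (t - b)).
have pR t : b <= t -> (if t <= b then q t else c (t - b)) = c (t - b).
  by case: (leP t b) => // tb bt; rewrite (@le_anti _ _ t b) ?tb // subrr c0.
split=> [|t ->//|s t bs st tl]; first by rewrite pR ?lerDl // addrC addKr.
rewrite !pR ?(le_trans bs) // cg; [|by apply/andP; split; lra..].
by rewrite ler0_norm; lra.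
Qed.

Lemma quasi_geodesic_append (K A a b : R) (q : R -> X) z : 1 <= K -> 0 <= A ->
  quasi_geodesic d K A a b q -> almost_nearest z q a b b ->
  exists p, [/\ quasi_geodesic d (2 * K + 1) (A + 1) a (b + d z (q b)) p,
    p (b + d z (q b)) = z & forall t, t <= b -> p t = q t].
Proof.
move=> K_ge1 A_ge0 /(quasi_geodesicP _ _ _ _ K_ge1)[ab qg] bmin.
have [p [pz pq pg]] := geodesic_extension q b z; exists p; split=> //.
have l0 := dist_ge0 z (q b); set l := d z (q b) in pz pg l0 *.
apply/quasi_geodesicP; first lra.
split=> [|s t as_ st tl]; first lra.
have e0 := dist_ge0 (p s) (p t).
case: (leP t b) => [tb|/ltW bt].
  by rewrite !pq ?(le_trans st) // in e0 *; have [] := qg s t as_ st tb; split; nra.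
case: (leP b s) => [bs|/ltW sb]; first by rewrite pg //; split; nra.
have [qsb1 qsb2] := qg s b as_ sb (lexx b).
have ptb : d (q b) (p t) = t - b by rewrite -(pq b) ?pg.
have ptz : d (p t) z = b + l - t by rewrite -{1}pz pg.
have [||tb1 tb2] := @almost_nearest_detour (p s) (q b) z (p t).
- by rewrite !(distC _ z) pq //; apply: bmin; rewrite as_.
- by rewrite ptb ptz (distC _ z) -/l; ring.
rewrite ptb pq // in tb1 tb2 e0 *; split.
  have : K * (d (q s) (q b) + A) <= K * (2 * d (q s) (p t) + 1 + A).
    by rewrite ler_pM2l; lra.
  by nra.
by have := dist_triangle (q b) (q s) (p t); rewrite ptb; nra.
Qed.

Lemma quasi_geodesic_prepend (K A a b : R) (q : R -> X) z : 1 <= K -> 0 <= A ->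
  quasi_geodesic d K A a b q -> almost_nearest z q a b a ->
  exists p, [/\ quasi_geodesic d (2 * K + 1) (A + 1) (a - d z (q a)) b p,
    p (a - d z (q a)) = z & forall t, a <= t -> p t = q t].
Proof.
move=> K_ge1 A_ge0 /quasi_geodesic_opp qg amin.
have [|p []] := quasi_geodesic_append K_ge1 A_ge0 qg (z := z).
  move=> s /andP[bs sa]; rewrite /= opprK; apply: amin.
  by apply/andP; split; lra.
rewrite /= opprK => /quasi_geodesic_opp pg pz pq.
have aE : - (- a + d z (q a)) = a - d z (q a) by rewrite opprD opprK.
exists (p \o -%R); split; first by rewrite opprK aE in pg.
- by rewrite /= -aE opprK.
- by move=> t at_; rewrite /= pq ?opprK // lerN2.
Qed.

Definition qi_embedding (K A : R) (h : X -> X) := forall x y,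
  d x y / K - A <= d (h x) (h y) /\ d (h x) (h y) <= K * d x y + A.

Definition displacement_le (h : X -> X) (S : set X) (D : R) :=
  forall y, S y -> d (h y) y <= D.

Lemma quasi_geodesic_comp (K A K' A' a b : R) (q : R -> X) h : 1 <= K -> 0 <= A' ->
  qi_embedding K A h -> quasi_geodesic d K' A' a b q ->
  quasi_geodesic d (K * K') (K * A' + A) a b (h \o q).
Proof.
move=> K_ge1 A'_ge0 hqi [ab qg]; split=> // s t sab tab.
have [lo hi] := qg s t sab tab; have [hlo hhi] := hqi (q s) (q t).
have K_gt0 : 0 < K by lra.
split; last first.
  by apply: le_trans hhi _; rewrite addrA lerD2r -mulrA -mulrDr ler_pM2l.
apply: le_trans hlo; rewrite invfM mulrCA mulrA opprD addrA lerD2r.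
have : (`|s - t| / K' - A') / K <= d (q s) (q t) / K by rewrite ler_pM2r ?invr_gt0.
have : A' / K <= K * A'.
  rewrite ler_pdivrMr //; have KA' : A' <= K * A' by rewrite ler_peMl.
  by apply: le_trans KA' _; rewrite ler_peMr // mulr_ge0 // ltW.
by rewrite mulrBl (mulrC _ K^-1); lra.
Qed.

(** * Morse rays *)

Lemma geodesic_ray_dist g (s t : R) : geodesic_ray d g -> 0 <= s -> s <= t ->
  d (g s) (g t) = t - s.
Proof.
by move=> g_ray s0 st; rewrite g_ray ?(le_trans s0) // distrC ger0_norm ?subr_ge0.
Qed.

Lemma geodesic_ray_quasi_geodesic g (s t : R) :
  geodesic_ray d g -> 0 <= s -> s <= t -> quasi_geodesic d 1 0 s t g.
Proof.
move=> g_ray s0 st; apply/quasi_geodesicP => //; split=> // u v su uv _.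
by rewrite geodesic_ray_dist // ?(le_trans s0) //; split; lra.
Qed.

Lemma geodesic_rays_param g1 g2 (s t : R) :
  geodesic_ray d g1 -> geodesic_ray d g2 -> 0 <= s -> 0 <= t ->
  t <= s + d (g1 s) (g2 t) + d (g1 0) (g2 0).
Proof.
move=> g1_ray g2_ray s0 t0.
have := geodesic_ray_dist g1_ray (lexx 0) s0.
have := geodesic_ray_dist g2_ray (lexx 0) t0.
have := dist_trianglel (g1 0) (g2 0) (g2 t).
by have := dist_triangle (g1 s) (g1 0) (g2 t); lra.
Qed.

Definition near_ray (g : R -> X) (C : R) (x : X) :=
  exists2 s : R, 0 <= s & d x (g s) <= C.

Lemma near_rayS g C C' x : C <= C' -> near_ray g C x -> near_ray g C' x.
Proof. by move=> CC' [s s0 xs]; exists s => //; exact: le_trans xs CC'. Qed.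

Lemma near_ray_trans g C C' x y : d x y <= C' -> near_ray g C y ->
  near_ray g (C' + C) x.
Proof.
by move=> xy [s s0 ys]; exists s => //; have := dist_triangle y x (g s); lra.
Qed.

Lemma near_ray_ge0 g C x : near_ray g C x -> 0 <= C.
Proof. by case=> s _; exact: le_trans (dist_ge0 _ _). Qed.

Lemma Morse_ray_stable g (K A C : R) : Morse_ray d g -> 1 <= K -> 0 <= A ->
  \forall C' \near +oo, forall (a b : R) q, quasi_geodesic d K A a b q ->
    near_ray g C (q a) -> near_ray g C (q b) ->
    forall t, a <= t <= b -> near_ray g C' (q t).
Proof.
move=> [_ [phi [_ gphi]]] K_ge1 A_ge0; near=> C' => a b q qg qa qb t tab.
have C0 := near_ray_ge0 qa.
have [[sa sa0 qsa] [sb sb0 qsb]] := (qa, qb).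
pose q' u := if u == a then g sa else if u == b then g sb else q u.
have qq' u : d (q u) (q' u) <= C.
  rewrite /q'; case: eqP => [->//|_]; case: eqP => [->//|_].
  by rewrite distxx.
apply: (@near_rayS _ (C + phi K (A + 2 * C))) => //.
apply: near_ray_trans (qq' t) _.
apply: gphi (quasi_geodesic_perturb K_ge1 qq' qg) _ _ _ tab => //; first lra.
  by exists sa => //; rewrite /q' eqxx.
by rewrite /q' eqxx; case: eqP => _; [exists sa|exists sb].
Unshelve. all: by end_near. Qed.

Lemma Morse_ray_shadows g1 g2 C : Morse_ray d g1 -> geodesic_ray d g2 ->
  (forall N : R, exists2 t, N <= t & near_ray g1 C (g2 t)) ->
  \forall C' \near +oo, forall t : R, 0 <= t -> near_ray g1 C' (g2 t).
Proof.
move=> g1_Morse g2_ray close; pose E := C + d (g1 0) (g2 0).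
have D0 := dist_ge0 (g1 0) (g2 0).
have C0 : 0 <= C by have [t _ /near_ray_ge0] := close 0.
apply: filterS (@Morse_ray_stable _ 1 0 E g1_Morse (lexx 1) (lexx 0)).
move=> C' stable t t0.
have [t' tt' t'near] := close t.
apply: (stable 0 t'); last by rewrite t0.
- by apply: geodesic_ray_quasi_geodesic => //; exact: le_trans tt'.
- by exists 0 => //; rewrite distC lerDr.
- by apply: near_rayS t'near; rewrite lerDl.
Qed.

(* Cut [q] at an almost nearest point to [g T] and close it up by a geodesic to
   [g T]; since [T] is large compared to [D], the cut lies beyond [c]. *)
Lemma quasi_geodesic_start_near_ray g (K A C0 : R) :
  Morse_ray d g -> 1 <= K -> 0 <= A ->
  \forall C \near +oo, forall D : R, \forall T \near +oo, forall (a b c : R) q,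
    quasi_geodesic d K A a b q -> d (q a) (g 0) <= C0 -> d (q b) (g T) <= D ->
    a <= c <= b -> c - a <= D -> near_ray g C (q c).
Proof.
move=> g_Morse K_ge1 A_ge0.
have [K'_ge1 A'_ge0] : 1 <= 2 * K + 1 /\ 0 <= A + 1 by split; lra.
apply: filterS (Morse_ray_stable C0 g_Morse K'_ge1 A'_ge0) => C stable D.
near=> T => a b c q qg qa qb /andP[ac cb] caD.
have TD : C0 + (K * D + A) + (D + 1) < T.
  by near: T; apply: nbhs_pinfty_gt; exact: num_real.
have C0_ge0 : 0 <= C0 by apply: le_trans qa; exact: dist_ge0.
have T0 : 0 <= T.
  have := le_trans (dist_ge0 _ _) qb; have : 0 <= K * D by nra.
  by lra.
have [t /andP[at_ tb] tmin] := almost_nearest_exists (g T) q qg.1.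
have ct : c <= t.
  rewrite leNgt; apply/negP => tc.
  have [_ /(_ a t (lexx a) at_ tb)[_ qat]] := (quasi_geodesicP _ _ _ _ K_ge1).1 qg.
  have qtD : d (g T) (q t) <= D + 1.
    have := tmin b; rewrite (distC _ (q b)) qg.1 lexx => /(_ isT); lra.
  have : K * (t - a) <= K * D by rewrite ler_pM2l; lra.
  have := dist_trianglel (q a) (g 0) (g T).
  rewrite (geodesic_ray_dist g_Morse.1 (lexx 0) T0).
  by have := dist_triangler (q t) (q a) (g T); lra.
have [p [pg pz pq]] := quasi_geodesic_append K_ge1 A_ge0
  (quasi_geodesic_sub (lexx a) at_ tb qg) (almost_nearest_sub (lexx a) tb tmin).
rewrite -pq //; apply: stable pg _ _ _ _.
- by exists 0; rewrite // pq.
- by exists T; rewrite // pz distxx.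
- by rewrite ac /= (le_trans ct) // lerDl dist_ge0.
Unshelve. all: by end_near. Qed.

Lemma quasi_geodesic_half_near_ray g o (K A : R) :
  Morse_ray d g -> 1 <= K -> 0 <= A ->
  \forall C \near +oo, forall D : R, \forall T \near +oo, forall (a b c : R) q,
    quasi_geodesic d K A a b q -> almost_nearest o q a b a -> a <= c <= b ->
    d o (q c) <= D -> d (q b) (g T) <= D -> near_ray g C (q c).
Proof.
move=> g_Morse K_ge1 A_ge0.
have [K'_ge1 A'_ge0] : 1 <= 2 * K + 1 /\ 0 <= A + 1 by split; lra.
apply: filterS (quasi_geodesic_start_near_ray (d o (g 0)) g_Morse K'_ge1 A'_ge0).
move=> C near_C D; apply: filterS (near_C (K * (2 * D + 1 + A) + D + 1)).
move=> T near_T a b c q qg amin acb ocD bTD.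
have /andP[ac cb] := acb.
have [p [pg po pq]] := quasi_geodesic_prepend K_ge1 A_ge0 qg amin.
have [ab qgP] := (quasi_geodesicP _ _ _ _ K_ge1).1 qg.
have D0 : 0 <= D by apply: le_trans ocD; exact: dist_ge0.
have KD_ge0 : 0 <= K * (2 * D + 1 + A) by apply: mulr_ge0; lra.
have oaD : d o (q a) <= D + 1 by have := amin c acb; lra.
rewrite -pq //; apply: near_T pg _ _ _ _.
- by rewrite po.
- by rewrite pq //; lra.
- by rewrite cb andbT; have := dist_ge0 o (q a); lra.
have : c - a <= K * (2 * D + 1 + A); last lra.
have [caqac _] := qgP a c (lexx a) ac cb; apply: le_trans caqac _.
by rewrite ler_pM2l; have := dist_trianglel o (q a) (q c); lra.
Qed.

Section TwoMorseRays.
Context {g1 g2 : R -> X}.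
Hypothesis (g1_Morse : Morse_ray d g1) (g2_Morse : Morse_ray d g2).
Hypothesis g1_g2_far : ~ finite_hausdorff d g1 g2.

Let g1_ray : geodesic_ray d g1. Proof. by case: g1_Morse. Qed.
Let g2_ray : geodesic_ray d g2. Proof. by case: g2_Morse. Qed.

Lemma Morse_rays_diverge C :
  \forall B \near +oo, forall s t : R, 0 <= s -> 0 <= t ->
    d (g1 s) (g2 t) <= C -> s <= B.
Proof.
suff [B B_bound] : exists B, forall s t, 0 <= s -> 0 <= t ->
    d (g1 s) (g2 t) <= C -> s <= B.
  near=> B' => s t s0 t0 st; apply: le_trans (B_bound _ _ s0 t0 st) _.
  by near: B'; apply: nbhs_pinfty_ge; exact: num_real.
apply: contrapT => /forallNP far; apply: g1_g2_far.
have {}far N : exists s t, [/\ 0 <= s, 0 <= t, N <= s & d (g1 s) (g2 t) <= C].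
  have /existsNP[s /existsNP[t]] := far N.
  move=> /not_implyP[s0 /not_implyP[t0 /not_implyP[st /negP]]].
  by rewrite -ltNge => /ltW Ns; exists s, t.
have g1_far N : exists2 s, N <= s & near_ray g2 C (g1 s).
  by have [s [t [_ t0 Ns st]]] := far N; exists s => //; exists t.
have g2_far N : exists2 t, N <= t & near_ray g1 C (g2 t).
  have [s [t [s0 t0 Ns st]]] := far (N + C + d (g1 0) (g2 0)).
  exists t; last by exists s; rewrite // distC.
  have := geodesic_rays_param g2_ray g1_ray t0 s0.
  by rewrite (distC (g2 t)) (distC (g2 0)); lra.
have [C' [g1_near g2_near]] := filter_ex (filterI
  (Morse_ray_shadows g2_Morse g1_ray g1_far)
  (Morse_ray_shadows g1_Morse g2_ray g2_far)).
exists C'; split=> [//|t t0]; have [s s0 ts] := g2_near t t0.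
by exists s; rewrite // distC.
Unshelve. all: by end_near. Qed.

Lemma Morse_rays_common_bounded o C :
  \forall B \near +oo, forall x, near_ray g1 C x -> near_ray g2 C x -> d x o <= B.
Proof.
have [B diverge] := filter_ex (Morse_rays_diverge (C + C)).
near=> B' => x [s s0 xs] [t t0 xt].
have sB : s <= B.
  by apply: diverge t0 _ => //; have := dist_trianglel x (g1 s) (g2 t); lra.
have : C + B + d (g1 0) o <= B' by [].
have := dist_triangle (g1 s) x o; have := dist_trianglel (g1 0) (g1 s) o.
by rewrite (geodesic_ray_dist g1_ray (lexx 0) s0); lra.
Unshelve. all: by end_near. Qed.

(* An almost nearest point [g1 u] to [g2 t] lies on a quasi-geodesic from [g1 0]
   to [g2 t], so it is close to [g2], and divergence bounds [u]. *)
Lemma Morse_rays_linear_divergence :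
  \forall M \near +oo, forall s t : R, 0 <= s -> 0 <= t ->
    s + t <= 3 * (d (g1 s) (g2 t) + M).
Proof.
pose D0 := d (g1 0) (g2 0); have D0_ge0 : 0 <= D0 := dist_ge0 _ _.
have [||C stable] :=
  filter_ex (@Morse_ray_stable _ (2 * 1 + 1) (0 + 1) D0 g2_Morse _ _).
- by lra.
- by lra.
have [B B0 diverge] := pinfty_ex_gt0 (Morse_rays_diverge C).
near=> M => s t s0 t0.
have [u /andP[u0 us] umin] := almost_nearest_exists (g2 t) g1 s0.
have [||p [pg pz pq]] := quasi_geodesic_append _ _
  (geodesic_ray_quasi_geodesic g1_ray (lexx 0) u0)
  (almost_nearest_sub (lexx 0) us umin) => //.
set l := d (g2 t) (g1 u) in pg pz; have l0 : 0 <= l := dist_ge0 _ _.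
have [|||v v0 uv] := stable _ _ _ pg _ _ u.
- by exists 0; rewrite ?pq.
- by exists t; rewrite // pz distxx.
- by rewrite u0 lerDl.
rewrite pq // in uv; have uB := diverge u v u0 v0 uv.
have ls : l <= d (g1 s) (g2 t) + 1.
  by rewrite (distC (g1 s)); apply: umin; rewrite s0 lexx.
have tu := geodesic_rays_param g1_ray g2_ray u0 t0.
rewrite (distC _ (g2 t)) -/l -/D0 in tu.
have su := dist_triangler (g2 t) (g1 u) (g1 s).
rewrite geodesic_ray_dist // (distC (g1 u)) -/l in su.
by have : B + D0 + 1 <= M by []; lra.
Unshelve. all: by end_near. Qed.

Definition biray (t : R) := if t < 0 then g1 (- t) else g2 t.

Lemma biray_quasi_geodesic :
  \forall M \near +oo, forall a b : R, a <= b ->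
    quasi_geodesic d 3 M a b biray.
Proof.
near=> M => a b ab; apply/quasi_geodesicP; first lra.
have D0M : d (g1 0) (g2 0) <= M by [].
have M_ge0 : 0 <= M by apply: le_trans D0M; exact: dist_ge0.
have linear : forall s t : R, 0 <= s -> 0 <= t -> s + t <= 3 * (d (g1 s) (g2 t) + M).
  by near: M; exact: Morse_rays_linear_divergence.
split=> // s t _ st _; rewrite /biray; case: (ltP t 0) => t0.
  rewrite (le_lt_trans st t0) distC geodesic_ray_dist ?lerN2 ?oppr_ge0 ?(ltW t0) //.
  by split; lra.
case: (ltP s 0) => s0; last by rewrite geodesic_ray_dist //; split; lra.
have Ns0 : 0 <= - s by lra.
split; first by have := linear _ _ Ns0 t0; lra.
have := dist_trianglel (g1 0) (g1 (- s)) (g2 t).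
have := dist_triangle (g2 0) (g1 0) (g2 t).
by rewrite !geodesic_ray_dist //; lra.
Unshelve. all: by end_near. Qed.

Lemma quasi_geodesic_near_rays o (K A : R) : 1 <= K -> 0 <= A ->
  \forall C \near +oo, forall D : R, \forall T \near +oo, forall (a b c : R) q,
    quasi_geodesic d K A a b q -> a <= c <= b ->
    d o (q c) <= D -> d (q a) (g1 T) <= D -> d (q b) (g2 T) <= D ->
    near_ray g1 C (q c) \/ near_ray g2 C (q c).
Proof.
move=> K_ge1 A_ge0.
apply: filterS2 (quasi_geodesic_half_near_ray o g1_Morse K_ge1 A_ge0)
  (quasi_geodesic_half_near_ray o g2_Morse K_ge1 A_ge0) => C near1 near2 D.
apply: filterS2 (near1 D) (near2 D) => T {}near1 {}near2.
move=> a b c q qg /andP[ac cb] ocD aD bD.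
have [t /andP[at_ tb] tmin] := almost_nearest_exists o q qg.1.
case: (leP t c) => [tc|/ltW ct]; [right|left].
  apply: near2 (quasi_geodesic_sub at_ tb (lexx b) qg) _ _ ocD bD; last by rewrite tc.
  exact: almost_nearest_sub tmin.
have := near1 _ _ (- c) _ (quasi_geodesic_opp (quasi_geodesic_sub (lexx a) at_ tb qg)).
rewrite /= !opprK; apply=> //; last by rewrite !lerN2 ct.
move=> s /andP[ts sa]; rewrite /= opprK; apply: tmin.
by rewrite lerNr sa lerNl (le_trans _ ts) // lerN2.
Qed.

Lemma qi_embedding_near_rays o (K A : R) : 1 <= K -> 0 <= A ->
  \forall C \near +oo, forall D : R, \forall r \near +oo, forall h,
    qi_embedding K A h -> displacement_le h (closed_mball d o r) D ->
    near_ray g1 C (h o) \/ near_ray g2 C (h o).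
Proof.
move=> K_ge1 A_ge0.
have [M M_gt0 biray_qg] := pinfty_ex_gt0 biray_quasi_geodesic.
have K3_ge1 : 1 <= K * 3 by lra.
have KMA_ge0 : 0 <= K * M + A by nra.
pose shift := K * d o (g2 0) + A.
have [N [_ near_rays]] := quasi_geodesic_near_rays o K3_ge1 KMA_ge0.
exists (shift + N); split=> [|C NC D]; first exact: num_real.
have NCs : N < C - shift by lra.
have [T T_gt0 near_T] := pinfty_ex_gt0 (near_rays _ NCs (d o (g2 0) + D)).
near=> r => h hqi hD.
have h_near g t : geodesic_ray d g -> d o (g 0) + T <= r -> 0 <= t -> t <= T ->
    d (h (g t)) (g t) <= D.
  move=> g_ray gr t0 tT; apply: hD; rewrite /closed_mball /=.
  by have := dist_triangle (g 0) o (g t); rewrite geodesic_ray_dist //; lra.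
have r1 : d o (g1 0) + T <= r by [].
have r2 : d o (g2 0) + T <= r by [].
have T_ge0 := ltW T_gt0; have o2 := dist_ge0 o (g2 0).
have NTT : - T <= T by lra.
have near_h0 :
    near_ray g1 (C - shift) (h (g2 0)) \/ near_ray g2 (C - shift) (h (g2 0)).
  have := near_T (- T) T 0 _
    (quasi_geodesic_comp K_ge1 (ltW M_gt0) hqi (biray_qg _ _ NTT)).
  rewrite /= /biray ltxx oppr_lt0 T_gt0 opprK ltNge T_ge0 /=; apply.
  - by rewrite oppr_le0 T_ge0.
  - have := h_near g2 0 g2_ray r2 (lexx 0) T_ge0.
    by have := dist_triangler (g2 0) o (h (g2 0)); lra.
  - by have := h_near g1 T g1_ray r1 T_ge0 (lexx T); lra.
  - by have := h_near g2 T g2_ray r2 T_ge0 (lexx T); lra.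
have h0 : d (h o) (h (g2 0)) <= shift := (hqi o (g2 0)).2.
by rewrite -(subrKC shift C); case: near_h0 => /(near_ray_trans h0); [left|right].
Unshelve. all: by end_near. Qed.

End TwoMorseRays.

(** * Rigidity of quasi-isometric embeddings *)

Hypothesis d_boundary : Morse_boundary_ge3 d.

(* The point [h o] is close to [g1] or [g2], to [g1] or [g3], and to [g2] or [g3]:
   it is close to two of the rays, which diverge. *)
Lemma qi_embedding_rigid_at : exists o, forall K A : R, 1 <= K -> 0 <= A ->
  exists B : R, forall D, exists r, forall h, qi_embedding K A h ->
    displacement_le h (closed_mball d o r) D -> d (h o) o <= B.
Proof.
have [g1 [g2 [g3 [g1_Morse [g2_Morse [g3_Morse far]]]]]] := d_boundary.
have [g12_far [g13_far g23_far]] := far.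
exists (g1 0) => K A K_ge1 A_ge0; set o := g1 0.
have [C [[near12 near13] near23]] := filter_ex (filterI (filterI
  (qi_embedding_near_rays g1_Morse g2_Morse g12_far o K_ge1 A_ge0)
  (qi_embedding_near_rays g1_Morse g3_Morse g13_far o K_ge1 A_ge0))
  (qi_embedding_near_rays g2_Morse g3_Morse g23_far o K_ge1 A_ge0)).
have [B [[B12 B13] B23]] := filter_ex (filterI (filterI
  (Morse_rays_common_bounded g1_Morse g2_Morse g12_far o C)
  (Morse_rays_common_bounded g1_Morse g3_Morse g13_far o C))
  (Morse_rays_common_bounded g2_Morse g3_Morse g23_far o C)).
exists B => D.
have [r [[{}near12 {}near13] {}near23]] := filter_ex (filterI (filterI
  (near12 D) (near13 D)) (near23 D)).
exists r => h hqi hD; case: (near12 h hqi hD) => [h1|h2].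
  by case: (near23 h hqi hD) => [h2|h3]; [exact: B12|exact: B13].
by case: (near13 h hqi hD) => [h1|h3]; [exact: B12|exact: B23].
Qed.

Hypothesis d_cocompact : cocompact d.

Lemma qi_embedding_rigid (K A : R) : 1 <= K -> 0 <= A ->
  exists B : R, forall D, exists r, forall h x, qi_embedding K A h ->
    displacement_le h (closed_mball d x r) D -> d (h x) x <= B.
Proof.
move=> K_ge1 A_ge0; have [p /(_ K A K_ge1 A_ge0)[B rigid_at]] := qi_embedding_rigid_at.
have [S [/(mcompact_bounded p)[r0 Sr0] covS]] := d_cocompact.
exists (K * r0 + A + B + r0) => D; have [r {}rigid_at] := rigid_at D.
exists (r0 + r) => h x hqi; have [f [f_iso [k Sk <-]]] := covS x => hD.
have [f_dist _] := f_iso; have [e [e_adj e_dist]] := isometry_inverse f_iso.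
have pk := Sr0 k Sk; pose h' := e \o h \o f.
have h'qi : qi_embedding K A h'.
  by move=> a b; rewrite /h' /= e_dist -(f_dist a); exact: hqi.
have h'p : d (h' p) p <= B.
  apply: rigid_at h'qi _ => y yr; rewrite /h' /= e_adj; apply: hD.
  rewrite /closed_mball /= in yr *; rewrite f_dist.
  by have := dist_trianglel p k y; lra.
rewrite -e_adj -/(h' k); have [_ h'pk] := h'qi k p; rewrite (distC k p) in h'pk.
have : K * d p k <= K * r0 by rewrite ler_pM2l; lra.
by have := dist_triangle (h' p) (h' k) k; have := dist_triangle p (h' p) k; lra.
Qed.

End Metric.

(** * Completion of a group by Cauchy sequences *)

Lemma fmap_ultra (T U : Type) (f : T -> U) (F : set_system T) :
  UltraFilter F -> UltraFilter (f @ F).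
Proof.
move=> FU; split; first exact: fmap_proper_filter.
move=> H HF FH; rewrite predeqE => A; split; last exact: FH.
move=> HA; have [//|FnA] := in_ultra_setVsetC (f @^-1` A) FU.
by have [x []] := filter_ex (filterI HA (FH (~` A) FnA)).
Qed.

Section Completion.
Local Open Scope group_scope.
Context {R : realType} {G : groupType} {V : nat -> set G} {len : G -> R}.

Definition lclose (k : nat) (x y : G) := V k (x^-1 * y).

Hypothesis V1 : forall k, V k 1.
Hypothesis V_divl : forall k x y, V k.+1 x -> V k.+1 y -> V k (x^-1 * y).
Hypothesis V_conj : forall r k, exists m, forall g x, len g <= r -> V m x ->
  V k (x ^ g).
Hypothesis V0_bounded : exists r, forall x, V 0%N x -> len x <= r.
Hypothesis len_mul : forall r s, exists t, forall g h, len g <= r -> len h <= s ->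
  len (g * h) <= t.
Hypothesis len_inv : forall r, exists t, forall g, len g <= r -> len g^-1 <= t.
Hypothesis bounded_ultra_cauchy : forall (F : set_system G) r k, UltraFilter F ->
  F [set g | len g <= r] -> exists t, F (lclose k t).

Lemma V_le k l : (k <= l)%N -> V l `<=` V k.
Proof.
move=> /subnK <-; elim: (l - k)%N => // n IH x Vx; apply: IH.
by have := V_divl (V1 _) Vx; rewrite invg1 mul1g.
Qed.

Lemma lclose_refl k x : lclose k x x.
Proof. by rewrite /lclose mulVg. Qed.

Lemma lclose_le k l x y : (k <= l)%N -> lclose l x y -> lclose k x y.
Proof. by move=> kl; exact: V_le. Qed.

Lemma lclose_euclid k x y z : lclose k.+1 x y -> lclose k.+1 x z -> lclose k y z.
Proof. by move=> xy /(V_divl xy); rewrite invgM invgK mulgA mulgK. Qed.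

Lemma lclose_sym k x y : lclose k.+1 x y -> lclose k y x.
Proof. by move=> /lclose_euclid; apply; exact: lclose_refl. Qed.

Lemma lclose_trans k x y z : lclose k.+2 x y -> lclose k.+1 y z -> lclose k x z.
Proof. by move=> /lclose_sym; exact: lclose_euclid. Qed.

Lemma lclose_mul r k : exists m, forall x x' y y', len y <= r ->
  lclose m x x' -> lclose m y y' -> lclose k (x * y) (x' * y').
Proof.
have [m Vm] := V_conj r k.+2; exists (maxn m k.+1) => x x' y y' yr xx' yy'.
apply: (@lclose_trans _ _ (x' * y)); last first.
  rewrite /lclose invgM -mulgA mulKg.
  by apply: lclose_le yy'; exact: leq_maxr.
have -> : lclose k.+2 (x * y) (x' * y) = V k.+2 ((x^-1 * x') ^ y).
  by rewrite /lclose conjgE invgM !mulgA.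
by apply: Vm => //; apply: lclose_le xx'; exact: leq_maxl.
Qed.

Lemma lclose_inv r k : exists m, forall x x', len x <= r ->
  lclose m x x' -> lclose k x^-1 x'^-1.
Proof.
have [t Vt] := len_inv r; have [m Vm] := V_conj t k.
exists m.+1 => x x' /Vt xt /lclose_sym /(Vm _ _ xt).
by rewrite /lclose conjgE !invgK mulgK.
Qed.

Lemma len_lclose r : exists s, forall x y, lclose 0 x y -> len x <= r -> len y <= s.
Proof.
have [q Vq] := V0_bounded; have [s len_s] := len_mul r q; exists s => x y xy xr.
by rewrite -(mulVKg x y); apply: len_s => //; exact: Vq.
Qed.

Definition eventually_close (k : nat) (u v : nat -> G) :=
  \forall n \near \oo, lclose k (u n) (v n).

Lemma eventually_close_refl k u : eventually_close k u u.
Proof. by apply: filterE => n; exact: lclose_refl. Qed.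

Lemma eventually_close_le k l u v : (k <= l)%N ->
  eventually_close l u v -> eventually_close k u v.
Proof. by move=> kl; apply: filterS => n; exact: lclose_le. Qed.

Lemma eventually_close_euclid k u v w :
  eventually_close k.+1 u v -> eventually_close k.+1 u w -> eventually_close k v w.
Proof. by apply: filterS2 => n; exact: lclose_euclid. Qed.

Lemma eventually_close_sym k u v :
  eventually_close k.+1 u v -> eventually_close k v u.
Proof. by apply: filterS => n; exact: lclose_sym. Qed.

Lemma eventually_close_trans k u v w :
  eventually_close k.+2 u v -> eventually_close k.+1 v w -> eventually_close k u w.
Proof. by apply: filterS2 => n; exact: lclose_trans. Qed.

Definition cauchy_seq (u : nat -> G) :=
  forall k, \forall n & m \near \oo, lclose k (u n) (u m).

Lemma cauchy_seq_tail u k : cauchy_seq u ->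
  \forall N \near \oo, eventually_close k (fun=> u N) u.
Proof.
move=> /(_ k)[[P Q] [nP nQ] PQ]; apply: filterS nP => N PN.
by apply: filterS nQ => n Qn; exact: (PQ (N, n)).
Qed.

Lemma cauchy_seq_bounded u : cauchy_seq u ->
  exists r, \forall n \near \oo, len (u n) <= r.
Proof.
move=> /cauchy_seq_tail-/(_ 0%N)/filter_ex[N uN].
have [s len_s] := len_lclose (len (u N)).
by exists s; apply: filterS uN => n uNn; exact: len_s uNn _.
Qed.

Lemma cauchy_seq_cst g : cauchy_seq (fun=> g).
Proof.
by move=> k; near=> n m; exact: lclose_refl.
Unshelve. all: by end_near. Qed.

Lemma cauchy_seq_mul u v : cauchy_seq u -> cauchy_seq v ->
  cauchy_seq (fun n => u n * v n).
Proof.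
move=> cu cv k; have [r vr] := cauchy_seq_bounded cv.
have [m close_m] := lclose_mul r k.
have vr2 : \forall i & j \near \oo, len (v i) <= r by exact: cvg_fst vr.
by apply: filterS3 vr2 (cu m) (cv m) => -[i j]; exact: close_m.
Qed.

Lemma cauchy_seq_inv u : cauchy_seq u -> cauchy_seq (fun n => (u n)^-1).
Proof.
move=> cu k; have [r ur] := cauchy_seq_bounded cu.
have [m close_m] := lclose_inv r k.
have ur2 : \forall i & j \near \oo, len (u i) <= r by exact: cvg_fst ur.
by apply: filterS2 ur2 (cu m) => -[i j]; exact: close_m.
Qed.

Lemma eventually_close_mul k u v : cauchy_seq v -> exists m, forall u' v',
  eventually_close m u u' -> eventually_close m v v' ->
  eventually_close k (fun n => u n * v n) (fun n => u' n * v' n).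
Proof.
move=> /cauchy_seq_bounded[r vr]; have [m close_m] := lclose_mul r k.
by exists m => u' v'; apply: filterS3 vr => n; exact: close_m.
Qed.

Lemma eventually_close_inv k u : cauchy_seq u -> exists m, forall u',
  eventually_close m u u' ->
  eventually_close k (fun n => (u n)^-1) (fun n => (u' n)^-1).
Proof.
move=> /cauchy_seq_bounded[r ur]; have [m close_m] := lclose_inv r k.
by exists m => u'; apply: filterS2 ur => n; exact: close_m.
Qed.

Definition cauchy_sequence := {u : nat -> G | cauchy_seq u}.
HB.instance Definition _ := gen_eqMixin cauchy_sequence.
HB.instance Definition _ := gen_choiceMixin cauchy_sequence.

Definition cauchy_equiv (u v : cauchy_sequence) : bool :=
  `[< forall k, eventually_close k (sval u) (sval v) >].

Let cauchy_equiv_refl : reflexive cauchy_equiv.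
Proof. by move=> u; apply/asboolP => k; exact: eventually_close_refl. Qed.

Let cauchy_equiv_sym : symmetric cauchy_equiv.
Proof.
by move=> u v; apply/idP/idP => /asboolP uv; apply/asboolP => k;
  exact: eventually_close_sym.
Qed.

Let cauchy_equiv_trans : transitive cauchy_equiv.
Proof.
move=> v u w /asboolP uv /asboolP vw; apply/asboolP => k.
exact: eventually_close_trans (uv _) (vw _).
Qed.

Canonical cauchy_equivRel :=
  EquivRel cauchy_equiv cauchy_equiv_refl cauchy_equiv_sym cauchy_equiv_trans.

Local Open Scope quotient_scope.

Definition completion : Type := {eq_quot cauchy_equiv}.
HB.instance Definition _ := Choice.on completion.
HB.instance Definition _ := EqQuotient.on completion.

Definition cseq (a : completion) : nat -> G := sval (repr a).

Lemma cseq_cauchy a : cauchy_seq (cseq a).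
Proof. exact: svalP. Qed.

Definition clim (u : nat -> G) (cu : cauchy_seq u) : completion :=
  \pi_completion (exist _ u cu).

Lemma clim_eq u v (cu : cauchy_seq u) (cv : cauchy_seq v) :
  clim cu = clim cv <-> forall k, eventually_close k u v.
Proof.
by split=> [/eqP|uv]; [|apply/eqP]; rewrite eqmodE; [move=> /asboolP|apply/asboolP].
Qed.

Lemma clim_ext u v (cu : cauchy_seq u) (cv : cauchy_seq v) :
  u =1 v -> clim cu = clim cv.
Proof.
by move=> uv; apply/clim_eq => k; rewrite (funext uv); exact: eventually_close_refl.
Qed.

Lemma cseqK a : clim (cseq_cauchy a) = a.
Proof.
rewrite -[RHS]reprK; apply/eqP; rewrite eqmodE; apply/asboolP => k.
exact: eventually_close_refl.
Qed.

Lemma climK u (cu : cauchy_seq u) k : eventually_close k u (cseq (clim cu)).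
Proof. by move: k; apply/(clim_eq cu (cseq_cauchy _)); rewrite cseqK. Qed.

Lemma completion_eqP a b : a = b <-> forall k, eventually_close k (cseq a) (cseq b).
Proof. by rewrite -(clim_eq (cseq_cauchy a) (cseq_cauchy b)) !cseqK. Qed.

Definition cclose (k : nat) (a : completion) : set completion :=
  [set b | eventually_close k (cseq a) (cseq b)].

Local Open Scope relation_scope.

Definition centourage (E : set (completion * completion)) :=
  exists k, forall a b, cclose k a b -> E (a, b).

Let centourage_filter : Filter centourage.
Proof.
split; first by exists 0%N.
  move=> E F [k Ek] [l Fl]; exists (maxn k l) => a b ab; split.
    by apply/Ek/(eventually_close_le _ ab)/leq_maxl.
  by apply/Fl/(eventually_close_le _ ab)/leq_maxr.
by move=> E F EF [k Ek]; exists k => a b /Ek; exact: EF.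
Qed.

Let centourage_diagonal E : centourage E -> diagonal `<=` E.
Proof.
by move=> [k Ek] [a b]; rewrite /diagonal /= => ->; exact/Ek/eventually_close_refl.
Qed.

Let centourage_inv E : centourage E -> centourage E^-1%relation.
Proof. by move=> [k Ek]; exists k.+1 => a b /eventually_close_sym; exact: Ek. Qed.

Let centourage_split E : centourage E -> exists2 F, centourage F & F \; F `<=` E.
Proof.
move=> [k Ek]; exists [set p | cclose k.+2 p.1 p.2]; first by exists k.+2.
move=> [a b] [c /= ac cb]; apply/Ek/(eventually_close_trans ac).
exact: eventually_close_le cb.
Qed.

HB.instance Definition _ := @isUniform.Build completion centourage
  centourage_filter centourage_diagonal centourage_inv centourage_split.

Local Close Scope relation_scope.

Lemma nbhs_completion (a : completion) (P : set completion) :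
  nbhs a P <-> exists k, cclose k a `<=` P.
Proof.
rewrite -nbhs_entourageE; split=> [[E [k Ek] EP]|[k kP]].
  by exists k => b /Ek ab; apply: EP; rewrite /xsection /= inE.
exists [set p | cclose k p.1 p.2]; first by exists k.
by move=> b; rewrite /xsection /= inE /=; exact: kP.
Qed.

Lemma cclose_nbhs k a : nbhs a (cclose k a).
Proof. by apply/nbhs_completion; exists k. Qed.

Definition cmul (a b : completion) :=
  clim (cauchy_seq_mul (cseq_cauchy a) (cseq_cauchy b)).
Definition cinv (a : completion) := clim (cauchy_seq_inv (cseq_cauchy a)).
Definition ccst (g : G) := clim (cauchy_seq_cst g).

Lemma clim_mul u v (cu : cauchy_seq u) (cv : cauchy_seq v) :
  clim (cauchy_seq_mul cu cv) = cmul (clim cu) (clim cv).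
Proof.
apply/clim_eq => k; have [m close_m] := eventually_close_mul k u cv.
by apply: close_m; exact: climK.
Qed.

Lemma clim_inv u (cu : cauchy_seq u) : clim (cauchy_seq_inv cu) = cinv (clim cu).
Proof.
apply/clim_eq => k; have [m close_m] := eventually_close_inv k cu.
by apply: close_m; exact: climK.
Qed.

Lemma ccst_mul g h : ccst (g * h) = cmul (ccst g) (ccst h).
Proof. by rewrite -clim_mul; exact: clim_ext. Qed.

Lemma completion_group : is_group cmul (ccst 1) cinv.
Proof.
split; [|split; [|split; [|split]]].
- move=> a b c; rewrite -(cseqK a) -(cseqK b) -(cseqK c) -!clim_mul.
  by apply: clim_ext => n; rewrite mulgA.
- by move=> a; rewrite -(cseqK a) -clim_mul; apply: clim_ext => n; rewrite mul1g.
- by move=> a; rewrite -(cseqK a) -clim_mul; apply: clim_ext => n; rewrite mulg1.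
- move=> a; rewrite -(cseqK a) -clim_inv -clim_mul.
  by apply: clim_ext => n; rewrite mulVg.
- move=> a; rewrite -(cseqK a) -clim_inv -clim_mul.
  by apply: clim_ext => n; rewrite mulgV.
Qed.

Lemma cclose_clim k u v (cu : cauchy_seq u) (cv : cauchy_seq v) :
  eventually_close k.+2 u v -> cclose k (clim cu) (clim cv).
Proof.
move=> uv; apply: (@eventually_close_euclid _ v); last exact: climK.
by apply: eventually_close_euclid uv _; exact: climK.
Qed.

Lemma cmul_continuous : continuous (fun p : completion * completion => cmul p.1 p.2).
Proof.
move=> [a b] P /nbhs_completion[k kP].
have [m close_m] := eventually_close_mul k.+2 (cseq a) (cseq_cauchy b).
exists (cclose m a, cclose m b); first by split; exact: cclose_nbhs.
by move=> [a' b'] [/= aa' bb']; apply: kP; apply: cclose_clim; exact: close_m.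
Qed.

Lemma cinv_continuous : continuous cinv.
Proof.
move=> a P /nbhs_completion[k kP].
have [m close_m] := eventually_close_inv k.+2 (cseq_cauchy a).
apply/nbhs_completion; exists m => b ab; apply: kP; apply: cclose_clim.
exact: close_m.
Qed.

Definition completion_topGroup : topGroup :=
  TopGroup completion_group cmul_continuous cinv_continuous.

Lemma completion_hausdorff : hausdorff_space completion.
Proof.
move=> a b ab; apply/completion_eqP => k.
have [c [ac bc]] := ab _ _ (cclose_nbhs k.+2 a) (cclose_nbhs k.+2 b).
by apply: eventually_close_trans ac _; exact: eventually_close_sym.
Qed.

Lemma ccst_dense : dense (range ccst).
Proof.
move=> U [a Ua] oU; have /nbhs_completion[k kU] : nbhs a U by exact: open_nbhs_nbhs.
have [N aN] := filter_ex (cauchy_seq_tail k.+1 (cseq_cauchy a)).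
exists (ccst (cseq a N)); split; last by exists (cseq a N).
by apply/kU/(eventually_close_euclid aN); exact: climK.
Qed.

Definition cbounded (r : R) : set completion :=
  [set a | \forall n \near \oo, len (cseq a n) <= r].

Lemma cbounded_cclose r : exists s, forall a b,
  cclose 0 a b -> cbounded r a -> cbounded s b.
Proof.
have [s len_s] := len_lclose r; exists s => a b; apply: filterS2 => n; exact: len_s.
Qed.

Lemma cbounded_ccst r : exists s, forall g, len g <= r -> cbounded s (ccst g).
Proof.
have [s len_s] := len_lclose r; exists s => g gr.
by apply: filterS (climK (cauchy_seq_cst g) 0) => n /len_s; apply.
Qed.

Lemma ccst_cbounded r : exists s, forall g, cbounded r (ccst g) -> len g <= s.
Proof.
have [s len_s] := len_lclose r; exists s => g gr.
have gK := eventually_close_sym (climK (cauchy_seq_cst g) 1).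
by have [n [gn /len_s]] := filter_ex (filterI gr gK); apply.
Qed.

Lemma cbounded_closure r (S : set completion) : S `<=` cbounded r ->
  exists s, closure S `<=` cbounded s.
Proof.
move=> Sr; have [s bnd_s] := cbounded_cclose r; exists s => a.
move=> /(_ _ (cclose_nbhs 1 a))[b [/Sr br /eventually_close_sym ba]].
exact: bnd_s ba br.
Qed.

Lemma ultrafilter_ccst_close r (F : set_system completion) k : UltraFilter F ->
  F (cbounded r) -> exists t, F [set a | eventually_close k (fun=> t) (cseq a)].
Proof.
move=> FU Fr; have [s len_s] := len_lclose r.
have pick a : exists g, eventually_close k.+1 (fun=> g) (cseq a).
  have [N aN] := filter_ex (cauchy_seq_tail k.+1 (cseq_cauchy a)).
  by exists (cseq a N).
have [f fP] := choice pick.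
have Ffs : F [set a | len (f a) <= s].
  apply: filterS Fr => a ar; have [n [far lan]] := filter_ex (filterI (fP a) ar).
  exact: len_s (lclose_le (leq0n k) (lclose_sym far)) lan.
have [t Ft] : exists t, F [set a | lclose k.+2 t (f a)] :=
  bounded_ultra_cauchy k.+2 (fmap_ultra f FU) Ffs.
exists t; apply: filterS Ft => a ta; apply: filterS (fP a) => n.
exact: lclose_trans.
Qed.

(* [t k] is [k]-close to [F]-almost every point; the sequence [t] is Cauchy and
   [F] converges to its limit. *)
Lemma ultrafilter_cvg r (F : set_system completion) : UltraFilter F ->
  F (cbounded r) -> exists p : completion, F --> p.
Proof.
move=> FU Fr; have [t Ft] := choice (fun k => ultrafilter_ccst_close k FU Fr).
have t_close k n m : (k.+2 <= n)%N -> (k.+2 <= m)%N -> lclose k (t n) (t m).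
  move=> kn km; have [a [an am]] := filter_ex (filterI (Ft n) (Ft m)).
  have [i [tni tmi]] := filter_ex (filterI an am).
  apply: (@lclose_trans _ _ (cseq a i)); first exact: lclose_le tni.
  by apply: lclose_sym; exact: lclose_le tmi.
have t_cauchy : cauchy_seq t.
  move=> k; exists ([set n | (k.+2 <= n)%N], [set m | (k.+2 <= m)%N]).
    by split; exact: nbhs_infty_ge.
  by move=> [n m] [/= kn km]; exact: t_close.
exists (clim t_cauchy) => P /nbhs_completion[k kP].
have [N [kN tN]] := filter_ex (filterI (nbhs_infty_ge k.+4)
  (cauchy_seq_tail k.+4 t_cauchy)).
apply: filterS (Ft N) => a ta; apply: kP.
apply: (@eventually_close_euclid _ t); first exact: climK.
apply: (@eventually_close_trans _ _ (fun=> t N)); last first.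
  exact: eventually_close_le (ltnW (ltnW kN)) ta.
by apply: filterS tN => n; exact: lclose_sym.
Qed.

Lemma cbounded_compact r (S : set completion) : S `<=` cbounded r ->
  compact (closure S).
Proof.
move=> /cbounded_closure[s Ss]; rewrite compact_ultra => F FU FS.
have [p Fp] := ultrafilter_cvg FU (filterS Ss FS); exists p; split=> //.
by apply: closed_closure => P /Fp FP; exact: filter_ex (filterI FS FP).
Qed.

Lemma completion_locally_bounded a : exists r, cclose 0 a `<=` cbounded r.
Proof.
have [r ar] := cauchy_seq_bounded (cseq_cauchy a).
by have [s bnd_s] := cbounded_cclose r; exists s => b ab; exact: bnd_s ar.
Qed.

Lemma compact_cbounded (K : set completion) :
  compact K -> exists r, K `<=` cbounded r.
Proof.
move=> /compact_near_coveringP K_cover.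
suff /filter_ex[r Kr] : \forall r \near +oo%R, K `<=` cbounded r by exists r.
apply: K_cover => a _; have [r ar] := completion_locally_bounded a.
exists (cclose 0 a, [set s | r <= s]).
  by split; [exact: cclose_nbhs|apply: nbhs_pinfty_ge; exact: num_real].
by move=> [b s] [/= /ar br rs]; apply: filterS br => n /le_trans; apply.
Qed.

Lemma completion_locally_compact : locally_compact [set: completion].
Proof.
move=> a _; have [r ar] := completion_locally_bounded a.
exists (closure (cclose 0 a)).
  by apply: filterS (cclose_nbhs 0 a) => b ab _; exact: subset_closure.
by split; [exact: cbounded_compact ar|exact: closed_closure].
Qed.

Lemma ccst_boundedP (T : set G) :
  (exists r, forall t, T t -> len t <= r) <-> compact (closure (ccst @` T)).
Proof.
split=> [[r Tr]|/compact_cbounded[r Tr]].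
  have [s bnd_s] := cbounded_ccst r.
  by apply: (@cbounded_compact s) => _ [t /Tr /bnd_s ts <-].
have [s bnd_s] := ccst_cbounded r; exists s => t Tt; apply: bnd_s.
by apply: Tr; apply: subset_closure; exists t.
Qed.

Lemma top_completion_exists :
  top_completion *%g (fun T => exists r, forall t, T t -> len t <= r).
Proof.
exists completion_topGroup, ccst; split; first exact: completion_hausdorff.
split; first exact: completion_locally_compact.
split; first exact: ccst_mul.
by split; [exact: ccst_dense|exact: ccst_boundedP].
Qed.

End Completion.

(** * Quasi-actions *)

Lemma ultra_lmem_exists (T I : Type) (F : set_system T) (P : I -> set T)
    (s : list I) :
  UltraFilter F -> F [set a | exists2 i, lmem i s & P i a] -> exists i, F (P i).
Proof.
move=> FU; elim: s => [|i s IH] Fs; first by have [a []] := filter_ex Fs.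
have [FP|FP] := in_ultra_setVsetC (P i) FU; first by exists i.
apply: IH; apply: filterS (filterI Fs FP) => a [[j /= [<-|js] Pja] nPia] //.
by exists j.
Qed.

Lemma filter_lmem_forall (T I : Type) (F : set_system T) (P : I -> set T)
    (s : list I) :
  Filter F -> (forall i, F (P i)) -> F [set a | forall i, lmem i s -> P i a].
Proof.
move=> FF FP; elim: s => [|i s IH]; first by apply: filterE => a i [].
by apply: filterS2 (FP i) IH => a Pia Ps j /= [<-//|]; exact: Ps.
Qed.

Section QuasiAction.
Context {R : realType} {X : Type} {d : X -> X -> R} {G : groupType}.
Context {K A : R} {act : G -> X -> X}.
Hypothesis d_metric : is_metric d.
Hypothesis act_quasi : quasi_action d *%g 1%g K A act.

Let K_ge1 : 1 <= K. Proof. by case: act_quasi. Qed.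
Let A_ge0 : 0 <= A. Proof. by case: act_quasi => _ []. Qed.

Lemma act_qi_embedding g : qi_embedding d K A (act g).
Proof. by case: act_quasi => _ [_ [+ _]] => /(_ g)[]. Qed.

Lemma act_mul g h x : d (act h (act g x)) (act (h * g)%g x) <= A.
Proof. by case: act_quasi => _ [_ [_ [+ _]]]; apply. Qed.

Lemma act_one x : d (act 1%g x) x <= A.
Proof. by case: act_quasi => _ [_ [_ [_ +]]]; apply. Qed.

Lemma act_lipschitz e g x y : d x y <= e -> d (act g x) (act g y) <= K * e + A.
Proof.
move=> xy; apply: le_trans (act_qi_embedding g x y).2 _.
by rewrite lerD2r ler_wpM2l // (le_trans ler01).
Qed.

Lemma act_inv g x : d (act g^-1%g (act g x)) x <= 2 * A.
Proof.
have := act_mul g g^-1%g x; rewrite mulVg => g'gx.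
have := dist_triangle d_metric (act 1%g x) (act g^-1%g (act g x)) x.
by have := act_one x; lra.
Qed.

Lemma act_inv_close e g x y :
  d y (act g x) <= e -> d (act g^-1%g y) x <= K * e + 3 * A.
Proof.
move=> /(act_lipschitz g^-1%g) g'y; have g'gx := act_inv g x.
by have := dist_triangle d_metric (act g^-1%g (act g x)) (act g^-1%g y) x; lra.
Qed.

Lemma act_divl e g h x : d (act h x) (act g x) <= e ->
  d (act (g^-1 * h)%g x) x <= K * e + 4 * A.
Proof.
move=> /act_inv_close g'hx; have g'h := act_mul h g^-1%g x.
have := dist_trianglel d_metric (act g^-1%g (act h x)) (act (g^-1 * h)%g x) x.
by lra.
Qed.

Context (x0 : X).
Let len g := d (act g x0) x0.

Lemma act_len_mul r s g h : len g <= r -> len h <= s ->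
  len (g * h)%g <= r + K * s + 2 * A.
Proof.
rewrite /len => gr /(act_lipschitz g) gh; have ghA := act_mul h g x0.
have := dist_trianglel d_metric (act g (act h x0)) (act (g * h)%g x0) x0.
by have := dist_triangle d_metric (act g x0) (act g (act h x0)) x0; lra.
Qed.

Lemma act_len_inv r g : len g <= r -> len g^-1%g <= K * r + 3 * A.
Proof. by rewrite /len (distC d_metric (act g x0)); exact: act_inv_close. Qed.

Lemma dist_act r s g y : len g <= r -> d x0 y <= s -> d x0 (act g y) <= r + K * s + A.
Proof.
rewrite /len => gr /(act_lipschitz g).
by have := dist_trianglel d_metric (act g x0) x0 (act g y); lra.
Qed.

Hypothesis d_proper : proper_space d.

Lemma bounded_ultrafilter_limit (F : set_system G) r y : UltraFilter F ->
  F [set g | len g <= r] -> exists z, F [set g | d z (act g y) < 1].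
Proof.
move=> FU Fr.
have [zs zs_net] := mcompact_net d_metric (@d_proper x0 (r + K * d x0 y + A)).
apply: (ultra_lmem_exists (P := fun z => [set g | d z (act g y) < 1]) (s := zs)).
by apply: filterS Fr => g gr; apply: zs_net; exact: dist_act.
Qed.

Lemma bounded_ultrafilter_close (F : set_system G) r s : UltraFilter F ->
  F [set g | len g <= r] -> exists t, F [set g | forall y, closed_mball d x0 s y ->
    d (act g y) (act t y) <= 2 * (K + A + 1)].
Proof.
move=> FU Fr.
have [z Fz] := choice (fun y => bounded_ultrafilter_limit y FU Fr).
have [ys ys_net] := mcompact_net d_metric (@d_proper x0 s).
have Fys : F [set g | forall y, lmem y ys -> d (z y) (act g y) < 1].
  exact: (filter_lmem_forall (P := fun y => [set g | d (z y) (act g y) < 1])).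
have [t zt] := filter_ex Fys; exists t.
apply: filterS Fys => g zg y /ys_net[y' y'ys /ltW y'y].
have close h : d (z y') (act h y') < 1 -> d (z y') (act h y) <= K + A + 1.
  have := dist_triangle d_metric (act h y') (z y') (act h y).
  by have := act_lipschitz h y'y; lra.
have := dist_trianglel d_metric (z y') (act g y) (act t y).
by have := close _ (zg _ y'ys); have := close _ (zt _ y'ys); lra.
Qed.

Let tolerance c := 2 * (c + K + A + 1).
Let divl_displacement c := K * tolerance c + 4 * A.

Section CoarseStabilizers.
Context {c rho : R}.
Hypothesis A_le_c : A <= c.
Hypothesis rho_gt0 : 0 < rho.
Hypothesis act_rigid : forall g x,
  displacement_le d (act g) (closed_mball d x rho) (divl_displacement c) ->
  d (act g x) x <= c.

Definition coarse_stabilizer (n : nat) : set G :=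
  [set g | displacement_le d (act g) (closed_mball d x0 (n%:R * rho)) c].

Lemma coarse_stabilizer_one n : coarse_stabilizer n 1%g.
Proof. by move=> y _; apply: le_trans A_le_c; exact: act_one. Qed.

Lemma coarse_stabilizer_bounded g : coarse_stabilizer 0 g -> len g <= c.
Proof. by apply; rewrite /closed_mball /= distxx // mul0r. Qed.

(* Rigidity brings the displacement of [g^-1 * h] on the ball of radius [n.+1 * rho],
   which exceeds [c], back to [c] on the ball of radius [n * rho]. *)
Lemma coarse_stabilizer_close n g h :
  (forall y, closed_mball d x0 (n.+1%:R * rho) y ->
    d (act h y) (act g y) <= tolerance c) ->
  coarse_stabilizer n (g^-1 * h)%g.
Proof.
move=> gh y yn; apply: act_rigid => y' yy'; apply/act_divl/gh.
rewrite /closed_mball /= in yn yy' *; rewrite -natr1 mulrDl mul1r.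
by have := dist_triangle d_metric y x0 y'; lra.
Qed.

Lemma coarse_stabilizer_divl n g h :
  coarse_stabilizer n.+1 g -> coarse_stabilizer n.+1 h ->
  coarse_stabilizer n (g^-1 * h)%g.
Proof.
move=> gV hV; apply: coarse_stabilizer_close => y yn.
have := dist_triangler d_metric y (act h y) (act g y).
by have := gV y yn; have := hV y yn; have := K_ge1; have := A_ge0;
  rewrite /tolerance; lra.
Qed.

Lemma coarse_stabilizer_conj r n : exists m, forall g h, len g <= r ->
  coarse_stabilizer m h -> coarse_stabilizer n (h ^ g)%g.
Proof.
pose s := r + K * (n.+1%:R * rho) + A; exists (Num.truncn (s / rho)).+1 => g h gr hV.
rewrite conjgE; apply: coarse_stabilizer_close => y yn.
have hgy : d (act h (act g y)) (act g y) <= c.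
  apply: hV; apply: le_trans (dist_act gr yn) _.
  by rewrite -ler_pdivrMr // ltW // truncnS_gt.
have := dist_trianglel d_metric (act h (act g y)) (act (h * g)%g y) (act g y).
by have := act_mul g h y; have := K_ge1; have := A_ge0; have := A_le_c;
  rewrite /tolerance; lra.
Qed.

Lemma bounded_ultrafilter_coset (F : set_system G) r n : UltraFilter F ->
  F [set g | len g <= r] -> exists t, F (lclose (V := coarse_stabilizer) n t).
Proof.
move=> FU /(bounded_ultrafilter_close (n.+1%:R * rho) FU)[t Ft].
exists t; apply: filterS Ft => g gt; apply: coarse_stabilizer_close => y /gt.
by have := A_ge0; have := A_le_c; rewrite /tolerance; lra.
Qed.

End CoarseStabilizers.

Hypothesis (d_geodesic : geodesic_space d) (d_cocompact : cocompact d).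
Hypothesis d_boundary : Morse_boundary_ge3 d.

Lemma quasi_action_rigid : exists2 c, A <= c & forall D, exists2 rho, 0 < rho &
  forall g x, displacement_le d (act g) (closed_mball d x rho) D ->
    d (act g x) x <= c.
Proof.
have [B rigid] :=
  qi_embedding_rigid d_metric d_geodesic d_boundary d_cocompact K_ge1 A_ge0.
exists (Num.max A B) => [|D]; first by rewrite le_max lexx.
have [r {}rigid] := rigid D; exists (Num.max r 1) => [|g x gD].
  by rewrite lt_max ltr01 orbT.
rewrite le_max (rigid _ _ (act_qi_embedding g)) ?orbT // => y yr; apply: gD.
by apply: le_trans yr _; rewrite le_max lexx.
Qed.

Lemma quasi_action_completion : top_completion *%g (qa_bounded d act x0).
Proof.
have [c A_le_c rigid] := quasi_action_rigid.
have [rho rho_gt0 act_rigid] := rigid (divl_displacement c).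
apply: (@top_completion_exists R G (coarse_stabilizer (c := c) (rho := rho)) len).
- exact: coarse_stabilizer_one.
- exact: coarse_stabilizer_divl.
- exact: coarse_stabilizer_conj.
- by exists c; exact: coarse_stabilizer_bounded.
- by move=> r s; exists (r + K * s + 2 * A) => g h; exact: act_len_mul.
- by move=> r; exists (K * r + 3 * A) => g; exact: act_len_inv.
- by move=> F r n; exact: bounded_ultrafilter_coset.
Qed.

End QuasiAction.

Theorem theoremD (R : realType) (X : Type) (d : X -> X -> R) :
  is_metric d -> proper_space d -> geodesic_space d -> cocompact d ->
  Morse_boundary_ge3 d ->
  forall (G : Type) (mul : G -> G -> G) (one : G) (inv : G -> G),
    is_group mul one inv ->
    forall act : G -> X -> X,
      (exists K A : R, quasi_action d mul one K A act) ->
      cobounded d act ->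
      forall x0 : X, top_completion mul (qa_bounded d act x0).
Proof.
move=> d_metric d_proper d_geodesic d_cocompact d_boundary G mul one inv.
move=> [mulA [mul1 [mulr1 [mulV mulrV]]]] act [K [A act_quasi]] _ x0.
pose gT : groupType := HB.pack {classic G}
  (isGroup.Build {classic G} mulA mul1 mulr1 mulV mulrV).
exact: (@quasi_action_completion R X d gT K A act).
Qed.
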